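(* Let $(S,T,m,n)$ be a sesquilaw of a monad $T$ over a monad $S$ on the same category. Then $k=m\circ n\colon TS\to TS$ (first $n$, then $m$) is an idempotent, and it is left-absorptive: for every object $X$, the following equation of morphisms $TSTSX\to STX$ holds, $$n_X\circ(\mu^{TS}_m)_X\circ m_{TSX}\circ n_{TSX}=n_X\circ(\mu^{TS}_m)_X .$$
   Context: For monads $(S,\mu^S,\eta^S)$ and $(T,\mu^T,\eta^T)$ on the same category: A distributive law of $S$ over $T$ is a natural transformation $m_X\colon STX\to TSX$ with $m_X\circ\mu^S_{TX}=T(\mu^S_X)\circ m_{SX}\circ S(m_X)$; $m_X\circ\eta^S_{TX}=T(\eta^S_X)$; $m_X\circ S(\mu^T_X)=\mu^T_{SX}\circ T(m_X)\circ m_{TX}$; $m_X\circ S(\eta^T_X)=\eta^T_{SX}$. An almost-distributive law of $T$ over $S$ is a natural transformation $n_X\colon TSX\to STX$ with $n_X\circ T(\mu^S_X)=\mu^S_{TX}\circ S(n_X)\circ n_{SX}$; $n_X\circ\eta^T_{SX}=S(\eta^T_X)$; $n_X\circ T(\eta^S_X)=\eta^S_{TX}$. A sesquilaw $(S,T,m,n)$ of $T$ over $S$ consists of a distributive law $m\colon ST\to TS$ and an almost-distributive law $n\colon TS\to ST$ such that (1) $n_X\circ\mu^T_{SX}\circ T(m_X)=S(\mu^T_X)\circ n_{TX}$ as maps $TSTX\to STX$, and (2) $n_X\circ m_X=\mathrm{id}_{STX}$. The distributive law $m$ induces a monad structure on $TS$ with multiplication $(\mu^{TS}_m)_X=\mu^T_{SX}\circ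 TT(\mu^S_X)\circ T(m_{SX})\colon TSTSX\to TSX$ and unit $\eta^T_{SX}\circ\eta^S_X$. *)

(* Defs.v *)
From Corelib Require Import ssreflect.

Set Implicit Arguments.
Unset Strict Implicit.
Unset Printing Implicit Defensive.

Declare Scope cat_scope.
Delimit Scope cat_scope with cat.
Open Scope cat_scope.

Reserved Notation "g ∘ f" (at level 40, left associativity).
Reserved Notation "G ⊚ F" (at level 40, left associativity).

Record category := Category {
  obj :> Type;
  hom : obj -> obj -> Type;
  idm : forall X, hom X X;
  comp : forall X Y Z, hom Y Z -> hom X Y -> hom X Z;
  comp_assoc : forall X Y Z W (h : hom Z W) (g : hom Y Z) (f : hom X Y),
    comp h (comp g f) = comp (comp h g) f;
  comp_idl : forall X Y (f : hom X Y), comp (idm Y) f = f;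
  comp_idr : forall X Y (f : hom X Y), comp f (idm X) = f
}.
Arguments idm {c} X.
Notation "g ∘ f" := (comp g f) : cat_scope.

Record functor (C D : category) := Functor {
  fobj :> C -> D;
  fmap : forall X Y, hom X Y -> hom (fobj X) (fobj Y);
  fmap_id : forall X, fmap (idm X) = idm (fobj X);
  fmap_comp : forall X Y Z (g : hom Y Z) (f : hom X Y),
    fmap (g ∘ f) = fmap g ∘ fmap f
}.
Arguments fmap {C D} f {X Y} _ : rename.

Definition functor_id (C : category) : functor C C.
Proof. by exists (fun X => X) (fun X Y f => f). Defined.

Definition functor_comp (C D E : category) (G : functor D E) (F : functor C D) :
  functor C E.
Proof.
exists (fun X => G (F X)) (fun X Y f => fmap G (fmap F f)).
- by move=> X; rewrite !fmap_id.
- by move=> X Y Z g f; rewrite !fmap_comp.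
Defined.
Notation "G ⊚ F" := (functor_comp G F) : cat_scope.

Record nat_trans (C D : category) (F G : functor C D) := NatTrans {
  component :> forall X : C, hom (F X) (G X);
  naturality : forall (X Y : C) (f : hom X Y),
    component Y ∘ fmap F f = fmap G f ∘ component X
}.

Definition nat_comp (C D : category) (F G H : functor C D)
  (b : nat_trans G H) (a : nat_trans F G) : nat_trans F H.
Proof.
exists (fun X => b X ∘ a X) => X Y f.
by rewrite -comp_assoc naturality !comp_assoc naturality.
Defined.

Record monad (C : category) := Monad {
  monad_functor :> functor C C;
  mu : nat_trans (monad_functor ⊚ monad_functor) monad_functor;
  eta : nat_trans (functor_id C) monad_functor;
  mu_assoc : forall X,
    mu X ∘ fmap monad_functor (mu X) = mu X ∘ mu (monad_functor X);
  mu_fmap_eta : forall X,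
    mu X ∘ fmap monad_functor (eta X) = idm (monad_functor X);
  mu_eta : forall X, mu X ∘ eta (monad_functor X) = idm (monad_functor X)
}.

Record distributive_law (C : category) (S T : monad C) := DistributiveLaw {
  dl_trans :> nat_trans (S ⊚ T) (T ⊚ S);
  dl_muS : forall X,
    dl_trans X ∘ mu S (T X)
    = fmap T (mu S X) ∘ dl_trans (S X) ∘ fmap S (dl_trans X);
  dl_etaS : forall X, dl_trans X ∘ eta S (T X) = fmap T (eta S X);
  dl_muT : forall X,
    dl_trans X ∘ fmap S (mu T X)
    = mu T (S X) ∘ fmap T (dl_trans X) ∘ dl_trans (T X);
  dl_etaT : forall X, dl_trans X ∘ fmap S (eta T X) = eta T (S X)
}.

(* Compared with a distributive law of T over S, only the compatibility with
   the multiplication of T is missing. *)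
Record almost_distributive_law (C : category) (T S : monad C) :=
  AlmostDistributiveLaw {
  adl_trans :> nat_trans (T ⊚ S) (S ⊚ T);
  adl_muS : forall X,
    adl_trans X ∘ fmap T (mu S X)
    = mu S (T X) ∘ fmap S (adl_trans X) ∘ adl_trans (S X);
  adl_etaT : forall X, adl_trans X ∘ eta T (S X) = fmap S (eta T X);
  adl_etaS : forall X, adl_trans X ∘ fmap T (eta S X) = eta S (T X)
}.

Record sesquilaw (C : category) (S T : monad C)
  (m : distributive_law S T) (n : almost_distributive_law T S) : Prop :=
  Sesquilaw {
  sesqui_muT : forall X,
    n X ∘ mu T (S X) ∘ fmap T (m X) = fmap S (mu T X) ∘ n (T X);
  sesqui_retract : forall X, n X ∘ m X = idm (S (T X))
}.

Section CompositeMonad.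
Variables (C : category) (S T : monad C) (m : distributive_law S T).

Lemma comp_substr (X Y Y' Z W : C) (f : hom X Y) (g : hom Y Z) (f' : hom X Y')
    (g' : hom Y' Z) (h : hom Z W) :
  g ∘ f = g' ∘ f' -> h ∘ g ∘ f = h ∘ g' ∘ f'.
Proof. by move=> e; rewrite -!comp_assoc e. Qed.

Definition dl_mu_component (X : C) : hom (T (S (T (S X)))) (T (S X)) :=
  mu T (S X) ∘ fmap T (fmap T (mu S X)) ∘ fmap T (m (S X)).

Definition dl_eta_component (X : C) : hom X (T (S X)) :=
  eta T (S X) ∘ eta S X.

Lemma dl_mu_natural (X Y : C) (f : hom X Y) :
  dl_mu_component Y ∘ fmap ((T ⊚ S) ⊚ (T ⊚ S)) f
  = fmap (T ⊚ S) f ∘ dl_mu_component X.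
Proof.
rewrite /dl_mu_component /=.
have e1 : fmap T (m (S Y)) ∘ fmap T (fmap S (fmap T (fmap S f)))
    = fmap T (fmap T (fmap S (fmap S f))) ∘ fmap T (m (S X)).
  by rewrite -!fmap_comp; congr (fmap T _); apply: (naturality m (fmap S f)).
have e2 : fmap T (fmap T (mu S Y)) ∘ fmap T (fmap T (fmap S (fmap S f)))
    = fmap T (fmap T (fmap S f)) ∘ fmap T (fmap T (mu S X)).
  rewrite -!fmap_comp; congr (fmap T (fmap T _)).
  exact: (naturality (mu S) f).
have e3 : mu T (S Y) ∘ fmap T (fmap T (fmap S f))
    = fmap T (fmap S f) ∘ mu T (S X).
  exact: (naturality (mu T) (fmap S f)).
by rewrite (comp_substr _ e1) (comp_substr _ e2) e3 !comp_assoc.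
Qed.

Lemma dl_eta_natural (X Y : C) (f : hom X Y) :
  dl_eta_component Y ∘ fmap (functor_id C) f
  = fmap (T ⊚ S) f ∘ dl_eta_component X.
Proof.
rewrite /dl_eta_component /=.
rewrite (comp_substr _ (naturality (eta S) f)) comp_assoc.
by congr (_ ∘ _); apply: (naturality (eta T) (fmap S f)).
Qed.

Definition dl_mu : nat_trans ((T ⊚ S) ⊚ (T ⊚ S)) (T ⊚ S) :=
  @NatTrans _ _ ((T ⊚ S) ⊚ (T ⊚ S)) (T ⊚ S) dl_mu_component dl_mu_natural.

Definition dl_eta : nat_trans (functor_id C) (T ⊚ S) :=
  @NatTrans _ _ (functor_id C) (T ⊚ S) dl_eta_component dl_eta_natural.

Lemma dl_mu_assoc (X : C) :
  dl_mu X ∘ fmap (T ⊚ S) (dl_mu X) = dl_mu X ∘ dl_mu ((T ⊚ S) X).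
Proof.
rewrite /= /dl_mu_component !fmap_comp !comp_assoc.
have a1 : fmap T (m (S X)) ∘ fmap T (fmap S (mu T (S X)))
    = fmap T (mu T (S (S X))) ∘ fmap T (fmap T (m (S X)))
      ∘ fmap T (m (T (S X))).
  by rewrite -!fmap_comp dl_muT.
have a2 : fmap T (m (T (S X))) ∘ fmap T (fmap S (fmap T (fmap T (mu S X))))
    = fmap T (fmap T (fmap S (fmap T (mu S X)))) ∘ fmap T (m (T (S (S X)))).
  rewrite -!fmap_comp; congr (fmap T _).
  exact: (naturality m (fmap T (mu S X))).
have a3 : fmap T (fmap T (m (S X))) ∘ fmap T (fmap T (fmap S (fmap T (mu S X))))
    = fmap T (fmap T (fmap T (fmap S (mu S X)))) ∘ fmap T (fmap T (m (S (S X)))).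
  rewrite -!fmap_comp; congr (fmap T (fmap T _)).
  exact: (naturality m (mu S X)).
have a4 : fmap T (mu T (S (S X))) ∘ fmap T (fmap T (fmap T (fmap S (mu S X))))
    = fmap T (fmap T (fmap S (mu S X))) ∘ fmap T (mu T (S (S (S X)))).
  rewrite -!fmap_comp; congr (fmap T _).
  exact: (naturality (mu T) (fmap S (mu S X))).
have a5 : fmap T (fmap T (mu S X)) ∘ fmap T (fmap T (fmap S (mu S X)))
    = fmap T (fmap T (mu S X)) ∘ fmap T (fmap T (mu S (S X))).
  by rewrite -!fmap_comp mu_assoc.
have a6 : fmap T (fmap T (mu S X)) ∘ fmap T (fmap T (mu S (S X)))
      ∘ fmap T (mu T (S (S (S X))))
    = fmap T (mu T (S X)) ∘ (fmap T (fmap T (fmap T (mu S X)))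
      ∘ fmap T (fmap T (fmap T (mu S (S X))))).
  rewrite -!fmap_comp; congr (fmap T _); symmetry.
  exact: (naturality (mu T) (mu S X ∘ mu S (S X))).
have b1 : fmap T (m (S X)) ∘ mu T (S (T (S X)))
    = mu T (T (S (S X))) ∘ fmap T (fmap T (m (S X))).
  by symmetry; apply: (naturality (mu T) (m (S X))).
have b2 : fmap T (fmap T (m (S X))) ∘ fmap T (fmap T (mu S (T (S X))))
    = fmap T (fmap T (fmap T (mu S (S X)))) ∘ fmap T (fmap T (m (S (S X))))
      ∘ fmap T (fmap T (fmap S (m (S X)))).
  by rewrite -!fmap_comp dl_muS.
have b3 : fmap T (fmap T (fmap S (m (S X)))) ∘ fmap T (m (S (T (S X))))
    = fmap T (m (T (S (S X)))) ∘ fmap T (fmap S (fmap T (m (S X)))).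
  rewrite -!fmap_comp; congr (fmap T _); symmetry.
  exact: (naturality m (m (S X))).
have b4 : fmap T (fmap T (mu S X)) ∘ mu T (T (S (S X)))
    = mu T (T (S X)) ∘ fmap T (fmap T (fmap T (mu S X))).
  by symmetry; apply: (naturality (mu T) (fmap T (mu S X))).
rewrite (comp_substr _ b1) -(comp_assoc _ _ (fmap T (fmap T (mu S (T (S X))))))
  b2 !comp_assoc (comp_substr _ b3) (comp_substr _ b4) -mu_assoc.
rewrite -(comp_assoc _ _ (fmap T (fmap S (mu T (S X))))) a1 !comp_assoc
  (comp_substr _ a2) (comp_substr _ a3) (comp_substr _ a4) (comp_substr _ a5).
by do 3 congr (_ ∘ _); move: a6; rewrite -!comp_assoc => ->.
Qed.

Lemma dl_mu_fmap_eta (X : C) :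
  dl_mu X ∘ fmap (T ⊚ S) (dl_eta X) = idm ((T ⊚ S) X).
Proof.
rewrite /= /dl_mu_component /dl_eta_component !fmap_comp !comp_assoc.
have e1 : fmap T (m (S X)) ∘ fmap T (fmap S (eta T (S X)))
    = fmap T (eta T (S (S X))) ∘ idm _.
  by rewrite comp_idr -fmap_comp dl_etaT.
have e2 : fmap T (fmap T (mu S X)) ∘ fmap T (eta T (S (S X)))
    = fmap T (eta T (S X)) ∘ fmap T (mu S X).
  rewrite -!fmap_comp; congr (fmap T _); symmetry.
  exact: (naturality (eta T) (mu S X)).
rewrite (comp_substr _ e1) comp_idr (comp_substr _ e2) mu_fmap_eta comp_idl.
by rewrite -fmap_comp mu_fmap_eta fmap_id.
Qed.

Lemma dl_mu_eta (X : C) :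
  dl_mu X ∘ dl_eta ((T ⊚ S) X) = idm ((T ⊚ S) X).
Proof.
rewrite /= /dl_mu_component /dl_eta_component !comp_assoc.
have e1 : fmap T (m (S X)) ∘ eta T (S (T (S X)))
    = eta T (T (S (S X))) ∘ m (S X).
  by symmetry; apply: (naturality (eta T) (m (S X))).
have e2 : fmap T (fmap T (mu S X)) ∘ eta T (T (S (S X)))
    = eta T (T (S X)) ∘ fmap T (mu S X).
  by symmetry; apply: (naturality (eta T) (fmap T (mu S X))).
rewrite (comp_substr _ e1) (comp_substr _ e2) mu_eta comp_idl.
by rewrite -comp_assoc dl_etaS -fmap_comp mu_eta fmap_id.
Qed.

Definition dl_monad : monad C :=
  @Monad C (T ⊚ S) dl_mu dl_eta dl_mu_assoc dl_mu_fmap_eta dl_mu_eta.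

End CompositeMonad.

Definition idempotent (C D : category) (F : functor C D) (k : nat_trans F F) :=
  nat_comp k k = k.

(* Main.v *)
Require Import Defs.
From Corelib Require Import ssreflect.
From Stdlib Require Import FunctionalExtensionality ProofIrrelevance.

(** Idempotency is formal: [n] is a retraction of [m], so [m n m n = m n].

    For left-absorptivity the point is that [n], applied after the
    multiplication of the composite monad [TS], sees its outer [TS] only through
    [n].  Indeed [n] satisfies the multiplication axiom for [S], which moves the
    [S]-multiplication past [n]; what remains of the composite multiplication is
    [mu T] preceded by the image under [T] of [m], and the axiom [sesqui_muT]
    turns this back into an [n] performed first.  This gives the factorization
    [adl_dl_mu], whose first step is [n] at [T (S X)].  Since [n m n = n],
    precomposing with [m n] changes nothing. *)

(** Idempotency equates whole natural transformations, records that carry a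
    naturality proof, while the sesquilaw axioms only compare components. *)
Lemma nat_trans_ext (C D : category) (F G : functor C D) (a b : nat_trans F G) :
  (forall X, a X = b X) -> a = b.
Proof.
case: a b => [a na] [b nb] /= e.
have {}e : a = b by apply: functional_extensionality_dep.
by case: _ / e nb => nb; rewrite (proof_irrelevance _ na nb).
Qed.

Lemma sesqui_adl_dl_adl {C : category} {S T : monad C}
  {m : distributive_law S T} {n : almost_distributive_law T S}
  (mn : sesquilaw m n) (X : C) :
  n X ∘ m X ∘ n X = n X.
Proof. by rewrite (sesqui_retract mn) comp_idl. Qed.

(** The form of the right-hand side is what matters: [n (T (S X))] comes first,
    so [n] after the composite multiplication factors through it and cannot
    distinguish two morphisms into [TSTSX] that [n (T (S X))] identifies. *)
Lemma adl_dl_mu {C : category} {S T : monad C}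
  {m : distributive_law S T} {n : almost_distributive_law T S}
  (mn : sesquilaw m n) (X : C) :
  n X ∘ mu (dl_monad m) X
  = mu S (T X) ∘ fmap S (n X) ∘ fmap S (mu T (S X)) ∘ n (T (S X)).
Proof.
rewrite /= /dl_mu_component.
(* The [S]-multiplication has to come last for the [mu S] axiom of [n]. *)
have e : mu T (S X) ∘ fmap T (fmap T (mu S X))
    = fmap T (mu S X) ∘ mu T (S (S X)).
  exact: (naturality (mu T) (mu S X)).
rewrite e !comp_assoc (adl_muS n).
by rewrite -!comp_assoc -(sesqui_muT mn) !comp_assoc.
Qed.

Theorem lemma3p5 (C : category) (S T : monad C)
  (m : distributive_law S T) (n : almost_distributive_law T S)
  (mn : sesquilaw m n) :
  idempotent (nat_comp m n) /\
  (forall X : C,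
     n X ∘ mu (dl_monad m) X ∘ m (T (S X)) ∘ n (T (S X))
     = n X ∘ mu (dl_monad m) X).
Proof.
split.
- apply: nat_trans_ext => X /=.
  by rewrite -comp_assoc (comp_assoc (n X)) (sesqui_adl_dl_adl mn).
- move=> X; rewrite (adl_dl_mu mn) -!comp_assoc (comp_assoc (n (T (S X)))).
  by rewrite (sesqui_adl_dl_adl mn).
Qed.
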